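(* Fix an integer $m\ge1$ and $\omega\in\mathbb Z\setminus\{0\}$. There exists $C_{m,\omega}>0$ such that every smooth closed immersed planar curve $\gamma$ with turning number $\omega[\gamma]=\omega$ satisfies $$\int_\gamma\mathcal K_m^2\,ds\ \ge\ C_{m,\omega}\,L[\gamma]^{-(2m+4)}E_m[\gamma].$$
   Context: $s$ arclength, $k$ signed curvature ($T=\partial_s\gamma$, $N=\mathsf RT$ with $\mathsf R(x,y)=(-y,x)$, $\partial_sT=kN$), $k_{s^j}$ the $j$-th arclength derivative of $k$, $L[\gamma]$ the length, $\omega[\gamma]=\frac1{2\pi}\int_\gamma k\,ds$ the turning number, $E_m[\gamma]=\frac12\int_\gamma k_{s^m}^2ds$, and $\mathcal K_m=(-1)^{m+1}k_{s^{2m+2}}-\tfrac12 k\,k_{s^m}^2+k\sum_{r=1}^m(-1)^{r+1}k_{s^{m-r}}k_{s^{m+r}}$. *)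

(* Defs.v *)
From Stdlib Require Import Reals List.
From Coquelicot Require Import Coquelicot.
Open Scope R_scope.

(* A closed planar curve is given by a 1-periodic parametrization
   gamma(t) = (cx t, cy t), t in R; one period is [0,1]. *)

Definition smooth (f : R -> R) : Prop := forall n t, ex_derive_n f n t.

Definition speed (cx cy : R -> R) (t : R) : R :=
  sqrt (Derive cx t ^ 2 + Derive cy t ^ 2).

Definition closed_immersed_curve (cx cy : R -> R) : Prop :=
  smooth cx /\ smooth cy /\
  (forall t, cx (t + 1) = cx t /\ cy (t + 1) = cy t) /\
  (forall t, 0 < Derive cx t ^ 2 + Derive cy t ^ 2).

Definition Ds (cx cy : R -> R) (f : R -> R) : R -> R :=
  fun t => Derive f t / speed cx cy t.

(* signed curvature k with T = d_s gamma, N = R T, R(x,y) = (-y,x), d_s T = k N *)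
Definition curvature (cx cy : R -> R) (t : R) : R :=
  (Derive cx t * Derive_n cy 2 t - Derive cy t * Derive_n cx 2 t)
  / (speed cx cy t ^ 3).

Definition k_s (cx cy : R -> R) (j : nat) : R -> R :=
  Nat.iter j (Ds cx cy) (curvature cx cy).

Definition curve_int (cx cy : R -> R) (f : R -> R) : R :=
  RInt (fun t => f t * speed cx cy t) 0 1.

Definition length (cx cy : R -> R) : R := curve_int cx cy (fun _ => 1).

Definition turning_number (cx cy : R -> R) : R :=
  / (2 * PI) * curve_int cx cy (curvature cx cy).

Definition energy (m : nat) (cx cy : R -> R) : R :=
  / 2 * curve_int cx cy (fun t => k_s cx cy m t ^ 2).

Definition Kop (m : nat) (cx cy : R -> R) (t : R) : R :=
  (-1) ^ (m + 1) * k_s cx cy (2 * m + 2) t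
  - / 2 * curvature cx cy t * k_s cx cy m t ^ 2
  + curvature cx cy t *
    fold_right Rplus 0
      (map (fun r => (-1) ^ (r + 1) * k_s cx cy (m - r) t * k_s cx cy (m + r) t)
           (seq 1 m)).

(* Main.v *)
(** Write [v = (-1)^(m+1) k_{s^{2m}}] and
    [Q = -1/2 k_{s^m}^2 + sum_{r=1}^m (-1)^(r+1) k_{s^{m-r}} k_{s^{m+r}}]. The sum
    telescopes to [Q_s = k v_s], while [K_m = v_ss + k Q]; hence the vector
    [W = v_s N + Q T] satisfies [W_s = K_m N] (translation invariance of [E_m]), and
    [W] stays within the L1 norm [delta] of [K_m] of its initial value [W_0].

    Normalise the length to one, and let [kappa = 2 pi omega] be the mean of [k].
    Since [T] has mean zero and [int Q = -(2m+1) E_m], the energy is at most a multiple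
    of [delta]; this settles the case of large energy. If the energy is small, then
    [k - kappa] is small. Integrating by parts [2m] times, [int v T] is of second order,
    because [int (k - kappa) T = 0]. Since [v_s] and [kappa v] are close to [<W_0,N>] and
    [<W_0,T>], the identity [|W_0|^2 = int <W_0,T>^2 + <W_0,N>^2] then bounds
    [W_0], hence [kappa v], by [delta] up to second-order terms, which are absorbed. As
    [kappa <> 0], this bounds [sup |v|], and with it the energy. *)

From Stdlib Require Import List Lra Lia FunctionalExtensionality.
Require Import Defs.
From Stdlib Require Import Reals ZArith.
From Coquelicot Require Import Coquelicot.
Open Scope R_scope.

(** * Smooth and periodic functions *)

(** Peels derivatives off from the inside, whereas [ex_derive_n] adds them on the outside. The
    closure properties below then follow by induction on [n] from the usual rules for one
    derivative. *)
Fixpoint derivable_upto (n : nat) (f : R -> R) : Prop :=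
  match n with
  | O => True
  | S n => (forall t, ex_derive f t) /\ derivable_upto n (Derive f)
  end.

Lemma Derive_n_Derive (f : R -> R) n : Derive_n (Derive f) n = Derive_n f (S n).
Proof.
induction n as [|n IH]; [reflexivity|].
simpl in *. now rewrite IH.
Qed.

Lemma ex_derive_n_Derive (f : R -> R) n t :
  ex_derive_n (Derive f) n t -> (n <> 0)%nat -> ex_derive_n f (S n) t.
Proof.
destruct n as [|n]; [easy|]. intros H _; simpl in *.
pose proof (Derive_n_Derive f n) as E; simpl in E. now rewrite <- E.
Qed.

Lemma smooth_Derive f : smooth f -> smooth (Derive f).
Proof.
intros H [|n] t; [exact I|].
pose proof (H (S (S n)) t) as Hn. simpl in *.
pose proof (Derive_n_Derive f n) as E; simpl in E. now rewrite E.
Qed.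

Lemma smooth_ex_derive f t : smooth f -> ex_derive f t.
Proof. intros H; exact (H 1%nat t). Qed.

Lemma smooth_derivable_upto f n : smooth f -> derivable_upto n f.
Proof.
revert f; induction n as [|n IH]; intros f H; simpl; [exact I|split].
- intros t; now apply smooth_ex_derive.
- now apply IH, smooth_Derive.
Qed.

Lemma derivable_upto_smooth f : (forall n, derivable_upto n f) -> smooth f.
Proof.
intros H n; specialize (H n); revert f H.
induction n as [|n IH]; intros f H t; [exact I|].
destruct H as [H1 H2].
destruct n as [|n]; [exact (H1 t)|].
apply ex_derive_n_Derive; [now apply IH|easy].
Qed.

Lemma derivable_upto_S n f : derivable_upto (S n) f -> derivable_upto n f.
Proof.
revert f; induction n as [|n IH]; intros f [H1 H2]; simpl; [exact I|].
split; [exact H1|now apply IH].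
Qed.

Lemma derivable_upto_const n c : derivable_upto n (fun _ => c).
Proof.
revert c; induction n as [|n IH]; intros c; simpl; [exact I|split].
- intros t; apply ex_derive_const.
- replace (Derive (fun _ => c)) with (fun _ : R => 0); [apply IH|].
  apply functional_extensionality; intros t; symmetry; apply Derive_const.
Qed.

Lemma derivable_upto_plus n f g :
  derivable_upto n f -> derivable_upto n g ->
  derivable_upto n (fun t => f t + g t).
Proof.
revert f g; induction n as [|n IH]; intros f g; simpl; [easy|].
intros [F1 F2] [G1 G2]; split.
- intros t; now apply (ex_derive_plus f g).
- replace (Derive (fun t => f t + g t)) with (fun t => Derive f t + Derive g t);
    [now apply IH|].
  apply functional_extensionality; intros t; symmetry; now apply Derive_plus.
Qed.

Lemma derivable_upto_mult n f g :
  derivable_upto n f -> derivable_upto n g ->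
  derivable_upto n (fun t => f t * g t).
Proof.
revert f g; induction n as [|n IH]; intros f g; [easy|].
intros F G; pose proof (derivable_upto_S _ _ F) as F0.
pose proof (derivable_upto_S _ _ G) as G0.
destruct F as [F1 F2], G as [G1 G2]; split.
- intros t; now apply ex_derive_mult.
- replace (Derive (fun t => f t * g t))
    with (fun t => Derive f t * g t + f t * Derive g t);
    [now apply derivable_upto_plus; apply IH|].
  apply functional_extensionality; intros t; symmetry; now apply Derive_mult.
Qed.

(** The derivative [- f' * (/ f) ^ 2] involves [/ f] again, but only to order [n], where the
    induction hypothesis applies. The square root below is treated in the same way. *)
Lemma derivable_upto_inv n f :
  (forall t, f t <> 0) -> derivable_upto n f -> derivable_upto n (fun t => / f t).
Proof.
intros Hf; induction n as [|n IH]; [easy|].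
intros F; pose proof (IH (derivable_upto_S _ _ F)) as F0.
destruct F as [F1 F2]; split.
- intros t; now apply ex_derive_inv.
- replace (Derive (fun t => / f t))
    with (fun t => ((-1) * Derive f t) * (/ f t * / f t)).
  + apply derivable_upto_mult; apply derivable_upto_mult; trivial.
    apply derivable_upto_const.
  + apply functional_extensionality; intros t; rewrite Derive_inv; trivial.
    field; apply Hf.
Qed.

Lemma derivable_upto_sqrt n f :
  (forall t, 0 < f t) -> derivable_upto n f ->
  derivable_upto n (fun t => sqrt (f t)).
Proof.
intros Hf; induction n as [|n IH]; [easy|].
intros F; pose proof (IH (derivable_upto_S _ _ F)) as F0.
destruct F as [F1 F2].
assert (D : forall t, is_derive (fun t => sqrt (f t)) t
                        (Derive f t * / (2 * sqrt (f t)))).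
{ intros t; auto_derive; [now split|]. change (fun x => f x) with f. field.
  apply Rgt_not_eq, sqrt_lt_R0, Hf. }
split.
- intros t; eexists; apply D.
- replace (Derive (fun t => sqrt (f t)))
    with (fun t => Derive f t * / (2 * sqrt (f t))).
  + apply derivable_upto_mult; trivial. apply derivable_upto_inv.
    * intros t; pose proof (sqrt_lt_R0 _ (Hf t)); lra.
    * apply derivable_upto_mult; trivial. apply derivable_upto_const.
  + apply functional_extensionality; intros t; symmetry.
    apply is_derive_unique, D.
Qed.

Lemma smooth_const c : smooth (fun _ => c).
Proof. apply derivable_upto_smooth; intros n; apply derivable_upto_const. Qed.

Lemma smooth_plus f g : smooth f -> smooth g -> smooth (fun t => f t + g t).
Proof.
intros F G; apply derivable_upto_smooth; intros n.
now apply derivable_upto_plus; apply smooth_derivable_upto.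
Qed.

Lemma smooth_mult f g : smooth f -> smooth g -> smooth (fun t => f t * g t).
Proof.
intros F G; apply derivable_upto_smooth; intros n.
now apply derivable_upto_mult; apply smooth_derivable_upto.
Qed.

Lemma smooth_inv f : (forall t, f t <> 0) -> smooth f -> smooth (fun t => / f t).
Proof.
intros H F; apply derivable_upto_smooth; intros n.
now apply derivable_upto_inv; [|apply smooth_derivable_upto].
Qed.

Lemma smooth_sqrt f : (forall t, 0 < f t) -> smooth f -> smooth (fun t => sqrt (f t)).
Proof.
intros H F; apply derivable_upto_smooth; intros n.
now apply derivable_upto_sqrt; [|apply smooth_derivable_upto].
Qed.

Lemma smooth_pow f n : smooth f -> smooth (fun t => f t ^ n).
Proof.
intros F; induction n as [|n IH]; simpl; [apply smooth_const|].
now apply smooth_mult.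
Qed.

Definition periodic (f : R -> R) : Prop := forall t, f (t + 1) = f t.

Lemma periodic_Derive f : smooth f -> periodic f -> periodic (Derive f).
Proof.
intros S P t.
assert (D : is_derive (fun x => f (x + 1)) t (Derive f (t + 1))).
{ auto_derive; [now apply smooth_ex_derive|]. change (fun x => f x) with f; ring. }
rewrite <- (is_derive_unique _ _ _ D).
apply Derive_ext; exact P.
Qed.

(** * Integration with respect to arclength *)

Definition cont (f : R -> R) : Prop := forall t, continuous f t.

Lemma cont_const c : cont (fun _ => c).
Proof. intros t; apply continuous_const. Qed.

Lemma cont_plus f g : cont f -> cont g -> cont (fun t => f t + g t).
Proof. intros F G t; now apply (continuous_plus f g). Qed.

Lemma cont_opp f : cont f -> cont (fun t => - f t).
Proof. intros F t; now apply (continuous_opp f). Qed.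

Lemma cont_minus f g : cont f -> cont g -> cont (fun t => f t - g t).
Proof. intros F G t; now apply (continuous_minus f g). Qed.

Lemma cont_mult f g : cont f -> cont g -> cont (fun t => f t * g t).
Proof. intros F G t; now apply (continuous_mult f g). Qed.

Lemma cont_pow f n : cont f -> cont (fun t => f t ^ n).
Proof.
intros F; induction n as [|n IH]; simpl; [apply cont_const|now apply cont_mult].
Qed.

Lemma cont_abs f : cont f -> cont (fun t => Rabs (f t)).
Proof. intros F t; apply (continuous_comp f Rabs); [apply F|apply continuous_Rabs]. Qed.

Ltac cont :=
  lazymatch goal with
  | |- cont (fun _ => ?c) => apply (cont_const c)
  | |- cont (fun t => @?f t + @?g t) => apply (cont_plus f g); cont
  | |- cont (fun t => @?f t - @?g t) => apply (cont_minus f g); cont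
  | |- cont (fun t => @?f t * @?g t) => apply (cont_mult f g); cont
  | |- cont (fun t => @?f t ^ ?n) => apply (cont_pow f n); cont
  | |- cont (fun t => - @?f t) => apply (cont_opp f); cont
  | |- cont (fun t => Rabs (@?f t)) => apply (cont_abs f); cont
  | |- _ => eauto 3
  end.

Definition wint (w f : R -> R) : R := RInt (fun t => f t * w t) 0 1.

(** The relation f_s = f' for ds = w dt, written without division so that the rules of calculus need
    no hypothesis on [w]. *)
Definition is_ds (w f f' : R -> R) : Prop :=
  forall t, is_derive f t (f' t * w t).

Lemma is_ds_cont w f f' : is_ds w f f' -> cont f.
Proof. intros H t; apply (ex_derive_continuous (V := R_NormedModule)); eexists; apply H. Qed.

Lemma is_ds_ext w f f' g' : (forall t, f' t = g' t) -> is_ds w f f' -> is_ds w f g'.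
Proof. intros E H t; rewrite <- E; apply H. Qed.

Lemma is_ds_const w c : is_ds w (fun _ => c) (fun _ => 0).
Proof. intros t; rewrite Rmult_0_l; apply (is_derive_const (V := R_NormedModule)). Qed.

Lemma is_ds_plus w f g f' g' :
  is_ds w f f' -> is_ds w g g' ->
  is_ds w (fun t => f t + g t) (fun t => f' t + g' t).
Proof.
intros F G t; rewrite Rmult_plus_distr_r.
apply (is_derive_plus f g); [apply F|apply G].
Qed.

Lemma is_ds_mult w f g f' g' :
  is_ds w f f' -> is_ds w g g' ->
  is_ds w (fun t => f t * g t) (fun t => f' t * g t + f t * g' t).
Proof.
intros F G t.
replace ((f' t * g t + f t * g' t) * w t)
  with (f' t * w t * g t + f t * (g' t * w t)) by ring.
apply (is_derive_mult f g); [apply F|apply G|intros; apply Rmult_comm].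
Qed.

Lemma is_ds_scal w c f f' :
  is_ds w f f' -> is_ds w (fun t => c * f t) (fun t => c * f' t).
Proof.
intros F. eapply is_ds_ext; [|apply is_ds_mult; [apply is_ds_const|apply F]].
intros t; simpl; ring.
Qed.

Lemma cont_ex_RInt f a b : cont f -> ex_RInt f a b.
Proof. intros F; apply (ex_RInt_continuous (V := R_CompleteNormedModule)); intros t _; apply F. Qed.

Lemma wint_ext_weight w w' f g :
  (forall t, f t * w t = g t * w' t) -> wint w f = wint w' g.
Proof. intros E; apply RInt_ext; intros t _; apply E. Qed.

Lemma wint_ext w f g : (forall t, f t = g t) -> wint w f = wint w g.
Proof. intros E; apply RInt_ext; intros t _; now rewrite E. Qed.

Lemma wint_lin w a b f g :
  cont w -> cont f -> cont g ->
  wint w (fun t => a * f t + b * g t) = a * wint w f + b * wint w g.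
Proof.
intros W F G; apply is_RInt_unique.
apply (is_RInt_ext (fun t => plus (scal a (f t * w t)) (scal b (g t * w t)))).
{ intros t _; unfold plus, scal; simpl; unfold mult; simpl; ring. }
apply (is_RInt_plus (V := R_NormedModule));
  apply (is_RInt_scal (V := R_NormedModule));
  apply (RInt_correct (V := R_CompleteNormedModule)), cont_ex_RInt; cont.
Qed.

Lemma wint_plus w f g :
  cont w -> cont f -> cont g -> wint w (fun t => f t + g t) = wint w f + wint w g.
Proof.
intros W F G. rewrite (wint_ext w _ (fun t => 1 * f t + 1 * g t)) by (intros; ring).
rewrite wint_lin by trivial; ring.
Qed.

Lemma wint_scal w c f : cont w -> cont f -> wint w (fun t => c * f t) = c * wint w f.
Proof.
intros W F. rewrite (wint_ext w _ (fun t => c * f t + 0 * f t)) by (intros; ring).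
rewrite wint_lin by trivial; ring.
Qed.

Lemma wint_le w f g :
  cont w -> (forall t, 0 < w t) -> cont f -> cont g ->
  (forall t, 0 <= t <= 1 -> f t <= g t) -> wint w f <= wint w g.
Proof.
intros W W0 F G H; apply RInt_le; [lra| | |]; try (apply cont_ex_RInt; cont).
intros t Ht; apply Rmult_le_compat_r; [left; apply W0|apply H; lra].
Qed.

Lemma wint_abs_le w f g :
  cont w -> (forall t, 0 < w t) -> cont f -> cont g ->
  (forall t, 0 <= t <= 1 -> Rabs (f t) <= g t) -> Rabs (wint w f) <= wint w g.
Proof.
intros W W0 F G H; apply Rabs_le; split.
- replace (- wint w g) with (wint w (fun t => (-1) * g t)).
  + apply wint_le; trivial; [cont|]. intros t Ht.
    specialize (H t Ht); apply Rabs_le_between in H; lra.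
  + rewrite wint_scal by trivial; ring.
- apply wint_le; trivial. intros t Ht.
  specialize (H t Ht); apply Rabs_le_between in H; lra.
Qed.

Lemma wint_ds w f f' : cont w -> cont f' -> is_ds w f f' -> wint w f' = f 1 - f 0.
Proof.
intros W F' H; apply is_RInt_unique.
apply (is_RInt_derive (V := R_CompleteNormedModule) f).
- intros t _; apply H.
- intros t _; revert t; change (cont (fun t => f' t * w t)); cont.
Qed.

(** The increment is the integral of [f'] between the two points, and enlarging the range to [0, 1]
    only increases the integral of the absolute value. *)
Lemma is_ds_osc w f f' a b :
  cont w -> (forall t, 0 < w t) -> cont f' -> is_ds w f f' ->
  0 <= a <= 1 -> 0 <= b <= 1 ->
  Rabs (f b - f a) <= wint w (fun t => Rabs (f' t)).
Proof.
intros W W0 F' H.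
assert (L : forall a b, 0 <= a -> a <= b -> b <= 1 ->
  Rabs (f b - f a) <= wint w (fun t => Rabs (f' t))).
{ clear a b; intros a b Ha Hab Hb.
  assert (C : cont (fun t => Rabs (f' t) * w t)) by cont.
  assert (P : forall c d, c <= d -> 0 <= RInt (fun t => Rabs (f' t) * w t) c d).
  { intros c d Hcd; apply RInt_ge_0; trivial; [now apply cont_ex_RInt|].
    intros t _; apply Rmult_le_pos; [apply Rabs_pos|left; apply W0]. }
  assert (E : f b - f a = RInt (fun t => f' t * w t) a b).
  { symmetry; apply is_RInt_unique.
    apply (is_RInt_derive (V := R_CompleteNormedModule) f).
    - intros t _; apply H.
    - intros t _; revert t; change (cont (fun t => f' t * w t)); cont. }
  rewrite E; unfold wint.
  rewrite <- (RInt_Chasles (fun t => Rabs (f' t) * w t) 0 a 1) by now apply cont_ex_RInt.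
  rewrite <- (RInt_Chasles (fun t => Rabs (f' t) * w t) a b 1) by now apply cont_ex_RInt.
  unfold plus; simpl.
  assert (Rabs (RInt (fun t => f' t * w t) a b)
          <= RInt (fun t => Rabs (f' t) * w t) a b).
  { eapply Rle_trans.
    - apply abs_RInt_le; [trivial|apply cont_ex_RInt; cont].
    - right; apply RInt_ext; intros t _.
      rewrite Rabs_mult, (Rabs_right (w t)); trivial. specialize (W0 t); lra. }
  pose proof (P 0 a Ha); pose proof (P b 1 Hb); lra. }
intros Ha Hb; destruct (Rle_dec a b).
- apply L; lra.
- rewrite Rabs_minus_sym; apply L; lra.
Qed.

(** A unit tangent [(T1, T2)] and the arclength derivatives [k j] of the curvature of
    a closed curve of length one, in a parametrization of speed [w] on [0, 1]. *)
Record closed_frame (w T1 T2 : R -> R) (k : nat -> R -> R) : Prop := {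
  cf_cont : cont w;
  cf_pos : forall t, 0 < w t;
  cf_length : wint w (fun _ => 1) = 1;
  cf_T1 : is_ds w T1 (fun t => - (k 0%nat t * T2 t));
  cf_T2 : is_ds w T2 (fun t => k 0%nat t * T1 t);
  cf_unit : forall t, T1 t ^ 2 + T2 t ^ 2 = 1;
  cf_k : forall j, is_ds w (k j) (k (S j));
  cf_per_T1 : T1 1 = T1 0;
  cf_per_T2 : T2 1 = T2 0;
  cf_per_k : forall j, k j 1 = k j 0;
  cf_close1 : wint w T1 = 0;
  cf_close2 : wint w T2 = 0
}.

(** * Mean values on a curve of length one *)

Section UnitLength.

Context (w : R -> R) (Wc : cont w) (Wp : forall t, 0 < w t)
  (W1 : wint w (fun _ => 1) = 1).

Lemma wint_const c : wint w (fun _ => c) = c.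
Proof.
rewrite (wint_ext w _ (fun _ => c * 1)) by (intros; ring).
rewrite wint_scal, W1; trivial; [ring|apply cont_const].
Qed.

Lemma wint_abs_bound f c :
  cont f -> (forall t, 0 <= t <= 1 -> Rabs (f t) <= c) -> Rabs (wint w f) <= c.
Proof.
intros F H; rewrite <- (wint_const c). apply wint_abs_le; trivial. apply cont_const.
Qed.

Lemma wint_le_bound f c :
  cont f -> (forall t, 0 <= t <= 1 -> f t <= c) -> wint w f <= c.
Proof.
intros F H; rewrite <- (wint_const c). apply wint_le; trivial. apply cont_const.
Qed.

Lemma wint_ge_bound f c :
  cont f -> (forall t, 0 <= t <= 1 -> c <= f t) -> c <= wint w f.
Proof.
intros F H; rewrite <- (wint_const c). apply wint_le; trivial. apply cont_const.
Qed.

Lemma wint_abs_nonneg f : cont f -> 0 <= wint w (fun t => Rabs (f t)).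
Proof. intros F; apply wint_ge_bound; [cont|]. intros; apply Rabs_pos. Qed.

Lemma wint_sqr_nonneg f : cont f -> 0 <= wint w (fun t => f t ^ 2).
Proof. intros F; apply wint_ge_bound; [cont|]. intros; apply pow2_ge_0. Qed.

(** With [c] the mean of [|f|] and total mass one, this is the nonnegativity of the integral of
    [(|f| - c)^2]. *)
Lemma wint_cauchy_schwarz f :
  cont f -> wint w (fun t => Rabs (f t)) ^ 2 <= wint w (fun t => f t ^ 2).
Proof.
intros F; set (c := wint w (fun t => Rabs (f t))).
assert (H : 0 <= wint w (fun t => 1 * f t ^ 2 + 1 * ((- 2 * c) * Rabs (f t) + c ^ 2 * 1))).
{ apply wint_ge_bound; [cont|]. intros t _.
  rewrite <- (pow2_abs (f t)).
  replace (_ + _) with ((Rabs (f t) - c) ^ 2) by ring. apply pow2_ge_0. }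
rewrite wint_lin, wint_lin, W1 in H by cont. fold c in H. lra.
Qed.

(** [f t - wint w f] is the average over [s] of [f t - f s], and each such difference is controlled
    by [is_ds_osc]. *)
Lemma osc_mean f f' t :
  cont f' -> is_ds w f f' -> 0 <= t <= 1 ->
  Rabs (f t - wint w f) <= wint w (fun t => Rabs (f' t)).
Proof.
intros F' H Ht.
pose proof (is_ds_cont _ _ _ H) as F.
replace (f t - wint w f) with (wint w (fun s => f t * 1 + (-1) * f s))
  by (rewrite wint_lin, W1; trivial; [ring|cont]).
apply wint_abs_bound; [cont|]. intros s Hs.
replace (f t * 1 + -1 * f s) with (f t - f s) by ring.
now apply is_ds_osc.
Qed.

Lemma wint_by_parts f g f' g' :
  cont f' -> cont g' -> is_ds w f f' -> is_ds w g g' ->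
  f 1 * g 1 = f 0 * g 0 ->
  wint w (fun t => f' t * g t) = - wint w (fun t => f t * g' t).
Proof.
intros F' G' F G E.
pose proof (is_ds_cont _ _ _ F); pose proof (is_ds_cont _ _ _ G).
assert (H1 := wint_ds w _ _ Wc (cont_plus _ _ (cont_mult _ _ F' H0) (cont_mult _ _ H G'))
  (is_ds_mult w f g f' g' F G)).
simpl in H1; rewrite wint_plus in H1 by cont. lra.
Qed.

End UnitLength.

(** * Framed closed curves of unit length *)

(** The partial sums of Q, with Q itself at [n = m]. They are kept separately because each has a
    one-term derivative, and because the last term of Q has to be split off later. *)
Fixpoint Qsum (k : nat -> R -> R) (m n : nat) (t : R) : R :=
  match n with
  | O => - / 2 * k m t ^ 2
  | S r => Qsum k m r t + (-1) ^ r * (k (m - S r)%nat t * k (m + S r)%nat t)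
  end.

(** [Kop] for an arbitrary sequence [k], so that it also applies to rescaled curvatures. Up to sign
    it is the L2 gradient of E_m. *)
Definition gradient (k : nat -> R -> R) (m : nat) (t : R) : R :=
  (-1) ^ (m + 1) * k (2 * m + 2)%nat t + k 0%nat t * Qsum k m m t.

Section Frame.

Context (w T1 T2 : R -> R) (k : nat -> R -> R) (H : closed_frame w T1 T2 k).

Let Wc := cf_cont _ _ _ _ H.
Let Wp := cf_pos _ _ _ _ H.
Let W1 := cf_length _ _ _ _ H.
Let kd := cf_k _ _ _ _ H.

Lemma cont_k j : cont (k j).
Proof. exact (is_ds_cont _ _ _ (kd j)). Qed.

Lemma cont_T1 : cont T1.
Proof. exact (is_ds_cont _ _ _ (cf_T1 _ _ _ _ H)). Qed.

Lemma cont_T2 : cont T2.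
Proof. exact (is_ds_cont _ _ _ (cf_T2 _ _ _ _ H)). Qed.

Lemma cont_Qsum m n : cont (Qsum k m n).
Proof.
pose proof cont_k as Ck.
induction n as [|n IH]; simpl; [change (cont (fun t => - / 2 * k m t ^ 2)); cont|].
change (cont (fun t => Qsum k m n t + (-1) ^ n * (k (m - S n)%nat t * k (m + S n)%nat t))).
cont.
Qed.

Lemma cont_gradient m : cont (gradient k m).
Proof. pose proof cont_k; pose proof cont_Qsum; unfold gradient; cont. Qed.

Lemma wint_k_S j : wint w (k (S j)) = 0.
Proof.
rewrite (wint_ds w (k j)); trivial; [|apply cont_k].
rewrite (cf_per_k _ _ _ _ H); ring.
Qed.

(** Telescoping: differentiating the term of index [n + 1] produces two products, one of which
    cancels the derivative of the previous partial sum. For [n = m] the outcome is [k v_s]. *)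
Lemma Qsum_ds m n : (n <= m)%nat ->
  is_ds w (Qsum k m n)
    (fun t => (-1) ^ (n + 1) * (k (m - n)%nat t * k (S (m + n)) t)).
Proof.
induction n as [|n IH]; intros Hn.
- eapply is_ds_ext;
    (* The factor [k m t * 1] matches the unfolding of [k m t ^ 2]. *)
    [|apply (is_ds_scal w (- / 2)), (is_ds_mult w (k m) (fun t => k m t * 1));
      [apply kd|apply is_ds_mult; [apply kd|apply is_ds_const]]].
  intros t; cbv beta. rewrite Nat.sub_0_r, Nat.add_0_r; simpl; field.
- simpl.
  eapply is_ds_ext;
    [|apply is_ds_plus; [apply IH; lia|
       apply is_ds_scal, is_ds_mult; apply kd]].
  intros t; cbv beta.
  replace (S (m - S n)) with (m - n)%nat by lia.
  replace (m + S n)%nat with (S (m + n)) by lia.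
  rewrite !pow_add; simpl; ring.
Qed.

(** Each of the [r] integrations by parts moves one derivative across and changes the sign. *)
Lemma wint_k_pair m r : (r <= m)%nat ->
  wint w (fun t => k (m - r)%nat t * k (m + r)%nat t)
    = (-1) ^ r * wint w (fun t => k m t ^ 2).
Proof.
induction r as [|r IH]; intros Hr.
- rewrite Nat.sub_0_r, Nat.add_0_r, Rmult_1_l.
  apply wint_ext; intros t; ring.
- assert (E : wint w (fun t => k (m - r)%nat t * k (m + r)%nat t)
    = - wint w (fun t => k (m - S r)%nat t * k (m + S r)%nat t)).
  { replace (m - r)%nat with (S (m - S r)) by lia.
    replace (m + S r)%nat with (S (m + r)) by lia.
    apply wint_by_parts; trivial; try apply cont_k.
    now rewrite !(cf_per_k _ _ _ _ H). }
  rewrite IH in E by lia.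
  replace ((-1) ^ S r) with (- (-1) ^ r) by (simpl; ring). lra.
Qed.

(** The alternating signs of the sum cancel those of [wint_k_pair], so every term contributes minus
    the integral of [k_m^2]. *)
Lemma wint_Qsum m n : (n <= m)%nat ->
  wint w (Qsum k m n) = - (/ 2 + INR n) * wint w (fun t => k m t ^ 2).
Proof.
pose proof cont_k as Ck.
induction n as [|n IH]; intros Hn.
- rewrite (wint_ext w _ (fun t => (- / 2) * k m t ^ 2)) by reflexivity.
  rewrite wint_scal by cont. simpl; ring.
- rewrite (wint_ext w _ (fun t => 1 * Qsum k m n t +
    (-1) ^ n * (k (m - S n)%nat t * k (m + S n)%nat t)))
    by (intros t; simpl; ring).
  rewrite wint_lin; trivial; [|apply cont_Qsum|cont].
  rewrite IH, wint_k_pair, S_INR by lia. simpl.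
  replace ((-1) ^ n * (-1 * (-1) ^ n * wint w (fun t => k m t * (k m t * 1))))
    with (- ((-1) * (-1)) ^ n * wint w (fun t => k m t * (k m t * 1)))
    by (rewrite Rpow_mult_distr; ring).
  replace ((-1) * (-1)) with 1 by ring. rewrite pow1; ring.
Qed.

(** * Constant vectors expressed in the moving frame *)

Section Combination.

Context (a b : R).

(** [comb_T] and [comb_N] are the components of the constant vector [(a, b)] along T and along N =
    (-T2, T1); hence the derivative of each is, up to sign, [k] times the other. *)
Definition comb_T (t : R) : R := a * T1 t + b * T2 t.
Definition comb_N (t : R) : R := b * T1 t - a * T2 t.

Lemma comb_T_ds : is_ds w comb_T (fun t => k 0%nat t * comb_N t).
Proof.
eapply is_ds_ext;
  [|apply is_ds_plus; apply is_ds_scal;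
    [apply (cf_T1 _ _ _ _ H)|apply (cf_T2 _ _ _ _ H)]].
intros t; unfold comb_N; simpl; ring.
Qed.

Lemma comb_N_ds : is_ds w comb_N (fun t => - (k 0%nat t * comb_T t)).
Proof.
assert (D : is_ds w (fun t => b * T1 t + (- a) * T2 t)
              (fun t => - (k 0%nat t * comb_T t))).
{ eapply is_ds_ext;
    [|apply is_ds_plus; apply is_ds_scal;
      [apply (cf_T1 _ _ _ _ H)|apply (cf_T2 _ _ _ _ H)]].
  intros t; unfold comb_T; simpl; ring. }
replace comb_N with (fun t => b * T1 t + (- a) * T2 t); [exact D|].
apply functional_extensionality; intros t; unfold comb_N; ring.
Qed.

Lemma cont_comb_T : cont comb_T.
Proof. exact (is_ds_cont _ _ _ comb_T_ds). Qed.

Lemma cont_comb_N : cont comb_N.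
Proof. exact (is_ds_cont _ _ _ comb_N_ds). Qed.

Lemma per_comb_T : comb_T 1 = comb_T 0.
Proof. unfold comb_T; now rewrite (cf_per_T1 _ _ _ _ H), (cf_per_T2 _ _ _ _ H). Qed.

Lemma per_comb_N : comb_N 1 = comb_N 0.
Proof. unfold comb_N; now rewrite (cf_per_T1 _ _ _ _ H), (cf_per_T2 _ _ _ _ H). Qed.

Lemma wint_comb_T : wint w comb_T = 0.
Proof.
unfold comb_T; rewrite wint_lin; trivial; [|apply cont_T1|apply cont_T2].
rewrite (cf_close1 _ _ _ _ H), (cf_close2 _ _ _ _ H); ring.
Qed.

Lemma wint_comb_N : wint w comb_N = 0.
Proof.
rewrite (wint_ext w _ (fun t => b * T1 t + (- a) * T2 t))
  by (intros t; unfold comb_N; ring).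
rewrite wint_lin; trivial; [|apply cont_T1|apply cont_T2].
rewrite (cf_close1 _ _ _ _ H), (cf_close2 _ _ _ _ H); ring.
Qed.

Lemma comb_sqr t : comb_T t ^ 2 + comb_N t ^ 2 = a ^ 2 + b ^ 2.
Proof.
rewrite <- (Rmult_1_r (a ^ 2 + b ^ 2)), <- (cf_unit _ _ _ _ H t).
unfold comb_T, comb_N; ring.
Qed.

Let rho := sqrt (a ^ 2 + b ^ 2).

Lemma rho_sqr : rho ^ 2 = a ^ 2 + b ^ 2.
Proof. apply pow2_sqrt. pose proof (pow2_ge_0 a); pose proof (pow2_ge_0 b); lra. Qed.

Lemma abs_comb_T t : Rabs (comb_T t) <= rho.
Proof.
unfold rho; rewrite <- (sqrt_Rsqr_abs (comb_T t)); apply sqrt_le_1_alt.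
rewrite <- (comb_sqr t); unfold Rsqr. pose proof (pow2_ge_0 (comb_N t)); lra.
Qed.

Lemma abs_comb_N t : Rabs (comb_N t) <= rho.
Proof.
unfold rho; rewrite <- (sqrt_Rsqr_abs (comb_N t)); apply sqrt_le_1_alt.
rewrite <- (comb_sqr t); unfold Rsqr. pose proof (pow2_ge_0 (comb_T t)); lra.
Qed.

End Combination.

End Frame.

(** * Estimates on framed closed curves *)

Lemma Rabs_mult_le x y a b : Rabs x <= a -> Rabs y <= b -> Rabs (x * y) <= a * b.
Proof.
intros Hx Hy; rewrite Rabs_mult; apply Rmult_le_compat; trivial; apply Rabs_pos.
Qed.

Lemma Rabs_plus_le x y a b : Rabs x <= a -> Rabs y <= b -> Rabs (x + y) <= a + b.
Proof. intros Hx Hy; eapply Rle_trans; [apply Rabs_triang|lra]. Qed.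

Section Estimates.

Context (w T1 T2 : R -> R) (k : nat -> R -> R) (H : closed_frame w T1 T2 k).

Let Wc := cf_cont _ _ _ _ H.
Let Wp := cf_pos _ _ _ _ H.
Let W1 := cf_length _ _ _ _ H.
Let kd := cf_k _ _ _ _ H.
Let Ck := cont_k _ _ _ _ H.

Let kap := wint w (k 0%nat).
Local Notation delta m := (wint w (fun t => Rabs (gradient k m t))).
Local Notation norm1 j := (wint w (fun t => Rabs (k j t))).

Lemma abs_T1 t : Rabs (T1 t) <= 1.
Proof.
pose proof (cf_unit _ _ _ _ H t); pose proof (pow2_ge_0 (T2 t)).
apply Rabs_le; split; nra.
Qed.

Lemma abs_T2 t : Rabs (T2 t) <= 1.
Proof.
pose proof (cf_unit _ _ _ _ H t); pose proof (pow2_ge_0 (T1 t)).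
apply Rabs_le; split; nra.
Qed.

(** Translation invariance of the energy: [K N] is the arclength derivative of the
    vector [W = v_s N + Q T], where [v = (-1)^(m+1) k_{2m}]; so [W] stays close to
    its initial value [(a, b)]. *)
Lemma force_almost_constant m : exists a b, forall t, 0 <= t <= 1 ->
  Rabs ((-1) ^ (m + 1) * k (2 * m + 1)%nat t - comb_N T1 T2 a b t) <= 2 * delta m /\
  Rabs (Qsum k m m t - comb_T T1 T2 a b t) <= 2 * delta m.
Proof.
set (d := delta m).
set (e := (-1) ^ (m + 1)).
set (K := gradient k m). set (Q := Qsum k m m).
pose proof (cont_T1 _ _ _ _ H) as C1; pose proof (cont_T2 _ _ _ _ H) as C2.
pose proof (cont_gradient _ _ _ _ H m) as CK; fold K in CK.
(* [F1] and [F2] are the Cartesian coordinates of W = v_s N + Q T. *)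
set (F1 := fun t => (- e) * (k (2 * m + 1)%nat t * T2 t) + Q t * T1 t).
set (F2 := fun t => e * (k (2 * m + 1)%nat t * T1 t) + Q t * T2 t).
assert (DQ : is_ds w Q (fun t => e * (k 0%nat t * k (2 * m + 1)%nat t))).
{ eapply is_ds_ext; [|apply (Qsum_ds _ _ _ _ H m m (le_n m))].
  intros t; cbv beta. rewrite Nat.sub_diag. do 4 f_equal; lia. }
assert (DK : is_ds w (k (2 * m + 1)%nat) (k (2 * m + 2)%nat)).
{ replace (2 * m + 2)%nat with (S (2 * m + 1)) by lia; apply kd. }
(* The terms in [k v_s] cancel between the two products, leaving the coordinate of [K N]. *)
assert (D1 : is_ds w F1 (fun t => - (K t * T2 t))).
{ eapply is_ds_ext; [|apply is_ds_plus;
    [apply is_ds_scal, is_ds_mult; [exact DK|apply (cf_T2 _ _ _ _ H)]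
    |apply is_ds_mult; [exact DQ|apply (cf_T1 _ _ _ _ H)]]].
  intros t; cbv beta. unfold K, gradient; fold e Q; ring. }
assert (D2 : is_ds w F2 (fun t => K t * T1 t)).
{ eapply is_ds_ext; [|apply is_ds_plus;
    [apply is_ds_scal, is_ds_mult; [exact DK|apply (cf_T1 _ _ _ _ H)]
    |apply is_ds_mult; [exact DQ|apply (cf_T2 _ _ _ _ H)]]].
  intros t; cbv beta. unfold K, gradient; fold e Q; ring. }
exists (F1 0), (F2 0).
assert (B1 : forall t, 0 <= t <= 1 -> Rabs (F1 t - F1 0) <= d).
{ intros t Ht. eapply Rle_trans; [apply (is_ds_osc w F1 (fun t => - (K t * T2 t)) 0 t); trivial; [cont|lra]|].
  unfold d; apply wint_le; trivial; [cont|cont|]. intros s _.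
  rewrite Rabs_Ropp, Rabs_mult. fold K.
  rewrite <- (Rmult_1_r (Rabs (K s))) at 2.
  apply Rmult_le_compat_l; [apply Rabs_pos|apply abs_T2]. }
assert (B2 : forall t, 0 <= t <= 1 -> Rabs (F2 t - F2 0) <= d).
{ intros t Ht. eapply Rle_trans; [apply (is_ds_osc w F2 (fun t => K t * T1 t) 0 t); trivial; [cont|lra]|].
  unfold d; apply wint_le; trivial; [cont|cont|]. intros s _.
  rewrite Rabs_mult. fold K.
  rewrite <- (Rmult_1_r (Rabs (K s))) at 2.
  apply Rmult_le_compat_l; [apply Rabs_pos|apply abs_T1]. }
intros t Ht.
specialize (B1 t Ht); specialize (B2 t Ht).
pose proof (abs_T1 t) as A1; pose proof (abs_T2 t) as A2.
pose proof (cf_unit _ _ _ _ H t) as U.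
(* A frame component of W - W_0 combines two coordinate deviations, each at most [d], with
   coefficients bounded by one; hence the factor 2. *)
replace (2 * d) with (d * 1 + d * 1) by ring.
split.
- replace (e * k (2 * m + 1)%nat t - _)
    with ((F2 t - F2 0) * T1 t + (F1 t - F1 0) * (- T2 t)).
  + apply Rabs_plus_le; apply Rabs_mult_le; trivial; now rewrite Rabs_Ropp.
  + transitivity (e * k (2 * m + 1)%nat t * (T1 t ^ 2 + T2 t ^ 2)
      - comb_N T1 T2 (F1 0) (F2 0) t); [|rewrite U; ring].
    unfold comb_N, F1 at 1, F2 at 1; ring.
- replace (Q t - _)
    with ((F1 t - F1 0) * T1 t + (F2 t - F2 0) * T2 t).
  + now apply Rabs_plus_le; apply Rabs_mult_le.
  + transitivity (Q t * (T1 t ^ 2 + T2 t ^ 2)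
      - comb_T T1 T2 (F1 0) (F2 0) t); [|rewrite U; ring].
    unfold comb_T, F1 at 1, F2 at 1; ring.
Qed.

(** The integral of [Q] is a multiple of the energy, and [Q] is close to a component
    of [T], which has mean zero. *)
Lemma energy_le_gradient m : (1 <= m)%nat ->
  wint w (fun t => k m t ^ 2) <= 2 * delta m.
Proof.
intros Hm.
destruct (force_almost_constant m) as (a & b & B).
set (e := wint w (fun t => k m t ^ 2)).
assert (He : 0 <= e) by exact (wint_sqr_nonneg w Wc Wp W1 _ (Ck m)).
pose proof (cont_Qsum _ _ _ _ H m m) as CQ.
pose proof (cont_comb_T _ _ _ _ H a b) as CT.
assert (I : Rabs (wint w (fun t => 1 * Qsum k m m t + (-1) * comb_T T1 T2 a b t))
            <= 2 * delta m).
{ apply wint_abs_bound; trivial; [cont|]. intros t Ht.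
  replace (1 * _ + _) with (Qsum k m m t - comb_T T1 T2 a b t) by ring.
  now apply B. }
rewrite wint_lin, (wint_comb_T _ _ _ _ H), (wint_Qsum _ _ _ _ H m m (le_n m)) in I by trivial.
fold e in I.
apply Rabs_le_between in I.
(* At this point [(m + 1/2) * e <= 2 * delta], and the coefficient is at least one. *)
assert (1 <= INR m) by now apply (le_INR 1).
nra.
Qed.

(** Derivatives of [k] of positive order have mean zero by periodicity, so [osc_mean] bounds them
    without a constant. *)
Lemma abs_k_le_norm1 j t : 0 <= t <= 1 -> Rabs (k (S j) t) <= norm1 (S (S j)).
Proof.
intros Ht. pose proof (osc_mean w Wc Wp W1 _ _ t (Ck _) (kd (S j)) Ht) as B.
rewrite (wint_k_S _ _ _ _ H) in B. now rewrite Rminus_0_r in B.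
Qed.

Lemma abs_dev_le_norm1 t : 0 <= t <= 1 -> Rabs (k 0%nat t - kap) <= norm1 1.
Proof. intros Ht. exact (osc_mean w Wc Wp W1 _ _ t (Ck _) (kd 0%nat) Ht). Qed.

(** On length one the L1 norm is at most the supremum, which the L1 norm of the next derivative
    bounds. The chain starts at order one because [k] itself has mean [kap]. *)
Lemma norm1_le_norm1 j n : (1 <= j)%nat -> (j <= n)%nat -> norm1 j <= norm1 n.
Proof.
intros Hj Hn; induction Hn as [|n Hn IH]; [lra|].
eapply Rle_trans; [exact IH|].
destruct n as [|n]; [lia|].
apply wint_le_bound; trivial; [cont|]. intros t Ht; now apply abs_k_le_norm1.
Qed.

Lemma norm1_nonneg j : 0 <= norm1 j.
Proof. now apply wint_abs_nonneg. Qed.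

(** The derivatives of [k - kap], order zero included: all of them have mean zero, so all are
    bounded by the highest one. *)
Definition dev (j : nat) (t : R) : R :=
  match j with O => k 0%nat t - kap | S _ => k j t end.

Lemma dev_ds j : is_ds w (dev j) (k (S j)).
Proof.
destruct j as [|j]; [|apply kd].
intros t; rewrite <- (Rplus_0_r (k 1%nat t * w t)).
apply (is_derive_plus (V := R_NormedModule)); [apply kd|].
apply (is_derive_const (V := R_NormedModule)).
Qed.

Lemma cont_dev j : cont (dev j).
Proof. exact (is_ds_cont _ _ _ (dev_ds j)). Qed.

Lemma per_dev j : dev j 1 = dev j 0.
Proof. destruct j; simpl; now rewrite (cf_per_k _ _ _ _ H). Qed.

Section Bounded.

Context (n : nat) (M : R) (Hn : (1 <= n)%nat)
  (HM : forall t, 0 <= t <= 1 -> Rabs (k n t) <= M).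

Lemma norm1_le_sup j : (1 <= j <= n)%nat -> norm1 j <= M.
Proof.
intros Hj; eapply Rle_trans; [apply (norm1_le_norm1 j n); lia|].
now apply wint_le_bound; [..|cont|].
Qed.

Lemma dev_le_sup j t : (j <= n)%nat -> 0 <= t <= 1 -> Rabs (dev j t) <= M.
Proof.
intros Hj Ht; destruct j as [|j]; simpl.
- eapply Rle_trans; [now apply abs_dev_le_norm1|apply norm1_le_sup; lia].
- destruct (Nat.eq_dec (S j) n) as [->|N]; [now apply HM|].
  eapply Rle_trans; [now apply abs_k_le_norm1|apply norm1_le_sup; lia].
Qed.

(** Integrating by parts [j] times reduces to [j = 0], where both integrals vanish
    because [k T] and [k N] are derivatives and [T], [N] have mean zero. *)
Lemma moment_bound a b j : (j <= n)%nat ->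
  let rho := sqrt (a ^ 2 + b ^ 2) in
  Rabs (wint w (fun t => comb_T T1 T2 a b t * dev j t))
    <= (Rabs kap + 1) ^ j * (norm1 1 * M * rho) /\
  Rabs (wint w (fun t => comb_N T1 T2 a b t * dev j t))
    <= (Rabs kap + 1) ^ j * (norm1 1 * M * rho).
Proof.
intros Hj rho.
set (X := comb_T T1 T2 a b); set (Y := comb_N T1 T2 a b).
pose proof (cont_comb_T _ _ _ _ H a b : cont X) as CX.
pose proof (cont_comb_N _ _ _ _ H a b : cont Y) as CY.
pose proof (comb_T_ds _ _ _ _ H a b : is_ds w X (fun t => k 0%nat t * Y t)) as DX.
pose proof (comb_N_ds _ _ _ _ H a b : is_ds w Y (fun t => - (k 0%nat t * X t))) as DY.
pose proof (per_comb_T _ _ _ _ H a b : X 1 = X 0) as PX.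
pose proof (per_comb_N _ _ _ _ H a b : Y 1 = Y 0) as PY.
assert (BX : forall t, Rabs (X t) <= rho) by apply (abs_comb_T _ _ _ _ H).
assert (BY : forall t, Rabs (Y t) <= rho) by apply (abs_comb_N _ _ _ _ H).
pose proof cont_dev as Cd.
set (G := norm1 1 * M * rho).
assert (HG : 0 <= G).
{ assert (0 <= M) by (eapply Rle_trans; [apply norm1_nonneg|apply (norm1_le_sup n); lia]).
  apply Rmult_le_pos; [apply Rmult_le_pos; trivial; apply norm1_nonneg|apply sqrt_pos]. }
induction j as [|j IH].
- simpl.
  assert (EX : wint w (fun t => X t * (k 0%nat t - kap)) = 0).
  { rewrite (wint_ext w _ (fun t => (-1) * (- (k 0%nat t * X t)) + (- kap) * X t))
      by (intros; ring).
    rewrite wint_lin; trivial; [|cont]. rewrite (wint_ds w Y) by (trivial; cont).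
    unfold X at 1; rewrite (wint_comb_T _ _ _ _ H), PY; ring. }
  assert (EY : wint w (fun t => Y t * (k 0%nat t - kap)) = 0).
  { rewrite (wint_ext w _ (fun t => 1 * (k 0%nat t * Y t) + (- kap) * Y t))
      by (intros; ring).
    rewrite wint_lin; trivial; [|cont]. rewrite (wint_ds w X) by (trivial; cont).
    unfold Y at 1; rewrite (wint_comb_N _ _ _ _ H), PX; ring. }
  rewrite EX, EY, Rabs_R0; lra.
- destruct IH as [IX IY]; [lia|].
  set (A := Rabs kap) in *.
  assert (HA : 0 <= A) by apply Rabs_pos.
  assert (HP : 1 <= (A + 1) ^ j) by (apply pow_R1_Rle; lra).
  (* After one integration by parts the integrand contains [k = kap + dev 0]. The part with [kap]
     multiplies the previous bound by [A], the other is of second order and at most [G]; and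
     [A * (A + 1) ^ j + 1 <= (A + 1) ^ S j]. *)
  assert (S1 : forall Z, cont Z -> (forall t, Rabs (Z t) <= rho) ->
    Rabs (wint w (fun t => Z t * dev j t)) <= (A + 1) ^ j * G ->
    Rabs (wint w (fun t => dev j t * (k 0%nat t * Z t))) <= (A + 1) ^ S j * G).
  { intros Z CZ BZ IZ.
    rewrite (wint_ext w _ (fun t => kap * (Z t * dev j t) + 1 * (dev 0 t * dev j t * Z t)))
      by (intros; simpl; ring).
    rewrite wint_lin by (trivial; cont).
    eapply Rle_trans.
    - apply Rabs_plus_le; [apply Rabs_mult_le; [apply Rle_refl|exact IZ]|].
      rewrite Rmult_1_l; apply (wint_abs_bound w Wc Wp W1 _ G); [cont|].
      intros t Ht; unfold G.
      apply Rabs_mult_le; [apply Rabs_mult_le|apply BZ].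
      + now apply abs_dev_le_norm1.
      + apply dev_le_sup; [lia|trivial].
    - fold A; simpl; nra. }
  split.
  + rewrite (wint_ext w _ (fun t => k (S j) t * X t)) by (intros; simpl; ring).
    rewrite (wint_by_parts w Wc (dev j) X _ _ (Ck _)
      (cont_mult _ _ (Ck _) CY) (dev_ds j) DX) by (now rewrite per_dev, PX).
    rewrite Rabs_Ropp; now apply S1.
  + rewrite (wint_ext w _ (fun t => k (S j) t * Y t)) by (intros; simpl; ring).
    rewrite (wint_by_parts w Wc (dev j) Y _ _ (Ck _)
      (cont_opp _ (cont_mult _ _ (Ck _) CX)) (dev_ds j) DY) by (now rewrite per_dev, PY).
    rewrite Rabs_Ropp.
    rewrite (wint_ext w _ (fun t => (-1) * (dev j t * (k 0%nat t * X t))))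
      by (intros; simpl; ring).
    rewrite wint_scal by (trivial; cont).
    rewrite Rabs_mult, Rabs_m1, Rmult_1_l; now apply S1.
Qed.

End Bounded.

(** For [m = S p], these are all terms of Q except the last, the only one containing [k]
    undifferentiated; they are of second order. The oscillation is at most the integral of
    [|k_1 k_{2m}|] by the telescoped derivative, and the mean is [-(p + 1/2)] times the integral of
    [k_m^2]; both integrals are at most [norm1 m * M]. *)
Lemma Qsum_pred_bound p M t :
  (forall t, 0 <= t <= 1 -> Rabs (k (2 * S p)%nat t) <= M) -> 0 <= t <= 1 ->
  Rabs (Qsum k (S p) p t) <= (INR p + 2) * (norm1 (S p) * M).
Proof.
intros HM Ht.
set (eta := norm1 (S p)).
assert (He : 0 <= eta) by apply norm1_nonneg.
assert (HM0 : 0 <= M) by (eapply Rle_trans; [apply Rabs_pos|apply (HM 0); lra]).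
pose proof (cont_Qsum _ _ _ _ H (S p) p) as CP.
assert (D := Qsum_ds _ _ _ _ H (S p) p ltac:(lia)).
assert (CD : cont (fun t => (-1) ^ (p + 1) * (k (S p - p)%nat t * k (S (S p + p)) t)))
  by cont.
assert (O := osc_mean w Wc Wp W1 _ _ t CD D Ht).
assert (O2 : wint w (fun t => Rabs ((-1) ^ (p + 1) *
   (k (S p - p)%nat t * k (S (S p + p)) t))) <= M * eta).
{ eapply Rle_trans; [|apply Rmult_le_compat_l; [exact HM0|apply (norm1_le_norm1 1 (S p)); lia]].
  rewrite <- wint_scal by cont.
  apply wint_le; trivial; [cont|cont|]. intros s Hs.
  rewrite !Rabs_mult, pow_1_abs, Rmult_1_l, Rmult_comm.
  replace (S p - p)%nat with 1%nat by lia.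
  replace (S (S p + p)) with (2 * S p)%nat by lia.
  apply Rmult_le_compat_r; [apply Rabs_pos|now apply HM]. }
assert (O3 : wint w (fun t => k (S p) t ^ 2) <= M * eta).
{ unfold eta; rewrite <- wint_scal by cont.
  apply wint_le; trivial; [cont|cont|]. intros s Hs.
  rewrite <- pow2_abs; simpl; rewrite Rmult_1_r.
  apply Rmult_le_compat_r; [apply Rabs_pos|].
  apply (dev_le_sup (2 * S p) M ltac:(lia) HM (S p)); [lia|trivial]. }
assert (O4 := wint_sqr_nonneg w Wc Wp W1 _ (Ck (S p))).
rewrite (wint_Qsum _ _ _ _ H (S p) p ltac:(lia)) in O.
set (e := wint w (fun t => k (S p) t ^ 2)) in *.
pose proof (pos_INR p).
apply Rabs_le_between in O.
apply Rabs_le; nra.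
Qed.

(** Collects the second-order errors of [sup_bound]: [2 * A * (A + 1) ^ (2 * m) + m + 3] from the
    bound on |W_0|, and [m + 2] from passing from <W_0,T> to [kap v]. *)
Definition small_const (A : R) (m : nat) : R :=
  2 * A * (A + 1) ^ (2 * m) + 2 * INR m + 5.

(** [M] is the maximum of [|k_{2m}|]. First |W_0| is bounded through the mean of <W_0,T>^2 +
    <W_0,N>^2, then the T component of W is read off at the maximum point [t0]. The last term is
    absorbed on the left once [norm1 m] is small. *)
Lemma sup_bound m M t0 : (1 <= m)%nat ->
  (forall t, 0 <= t <= 1 -> Rabs (k (2 * m)%nat t) <= M) ->
  0 <= t0 <= 1 -> Rabs (k (2 * m)%nat t0) = M ->
  Rabs kap * M <= 6 * delta m + small_const (Rabs kap) m * (norm1 m * M).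
Proof.
intros Hm HM Ht0 HM0.
destruct m as [|p]; [lia|].
destruct (force_almost_constant (S p)) as (a & b & B).
set (X := comb_T T1 T2 a b) in *; set (Y := comb_N T1 T2 a b) in *.
set (rho := sqrt (a ^ 2 + b ^ 2)).
set (P := Qsum k (S p) p). set (Q := Qsum k (S p) (S p)) in *.
set (s := (-1) ^ p).
assert (Es : (-1) ^ (S p + 1) = s) by (rewrite pow_add; unfold s; simpl; ring).
rewrite Es in B.
assert (As : Rabs s = 1) by apply pow_1_abs.
set (n := (2 * S p)%nat) in *.
(* Q = P + k v with v = [s * k n]; only [k v] is of first order. *)
assert (EQ : forall t, Q t = P t + s * (k 0%nat t * k n t)).
{ intros t; unfold Q, P; simpl Qsum. rewrite Nat.sub_diag.
  replace (S (p + S p)) with n by (unfold n; lia). reflexivity. }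
assert (En : (n + 1)%nat = S n) by lia.
rewrite En in B.
pose proof (cont_comb_T _ _ _ _ H a b : cont X) as CX.
pose proof (cont_comb_N _ _ _ _ H a b : cont Y) as CY.
pose proof (cont_Qsum _ _ _ _ H (S p) p : cont P) as CP.
pose proof (cont_Qsum _ _ _ _ H (S p) (S p) : cont Q) as CQ.
pose proof (comb_N_ds _ _ _ _ H a b : is_ds w Y (fun t => - (k 0%nat t * X t))) as DY.
assert (BX : forall t, Rabs (X t) <= rho) by apply (abs_comb_T _ _ _ _ H).
assert (BY : forall t, Rabs (Y t) <= rho) by apply (abs_comb_N _ _ _ _ H).
set (A := Rabs kap). assert (HA : 0 <= A) by apply Rabs_pos.
set (d := delta (S p)) in *. set (eta := norm1 (S p)).
assert (Hd : 0 <= d).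
{ exact (wint_abs_nonneg w Wc Wp W1 _ (cont_gradient _ _ _ _ H (S p))). }
assert (He : 0 <= eta) by apply norm1_nonneg.
assert (HMp : 0 <= M) by (rewrite <- HM0; apply Rabs_pos).
assert (Hr : 0 <= rho) by apply sqrt_pos.
assert (Ho : norm1 1 <= eta) by (apply norm1_le_norm1; lia).
assert (Ho0 : 0 <= norm1 1) by apply norm1_nonneg.
assert (BP : forall t, 0 <= t <= 1 -> Rabs (P t) <= (INR p + 2) * (eta * M))
  by (intros t Ht; now apply Qsum_pred_bound).
assert (Hn : (1 <= n)%nat) by (unfold n; lia).
assert (Bk : Rabs (wint w (fun t => X t * (k 0%nat t * k n t)))
             <= (A * (A + 1) ^ n + 1) * (eta * M * rho)).
{ rewrite (wint_ext w _ (fun t => kap * (X t * dev n t)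
    + 1 * (dev 0 t * k n t * X t))).
  2:{ intros t; unfold n; simpl; ring. }
  pose proof (cont_dev n); pose proof (cont_dev 0).
  rewrite wint_lin by (trivial; cont).
  rewrite Rmult_plus_distr_r, Rmult_assoc, !Rmult_1_l.
  apply Rabs_plus_le; [apply Rabs_mult_le; [apply Rle_refl|]|].
  - eapply Rle_trans; [apply (moment_bound n M Hn HM a b n (le_n n))|].
    fold A rho. apply Rmult_le_compat_l; [apply pow_le; lra|].
    apply Rmult_le_compat_r; trivial. now apply Rmult_le_compat_r.
  - apply wint_abs_bound; trivial; [cont|]. intros t Ht.
    apply Rabs_mult_le; [apply Rabs_mult_le|apply BX]; [|now apply HM].
    eapply Rle_trans; [now apply abs_dev_le_norm1|trivial]. }
(* Since the derivative of [Y] is [- k X], the T and N contributions to |W_0|^2 reduce to the same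
   integral, which [Bk] bounds. *)
assert (Bd : wint w (fun t => Y t * k (S n) t)
             = wint w (fun t => X t * (k 0%nat t * k n t))).
{ rewrite (wint_ext w _ (fun t => k (S n) t * Y t)) by (intros; ring).
  rewrite (wint_by_parts w Wc (k n) Y _ _ (Ck _)
    (cont_opp _ (cont_mult _ _ (Ck _) CX)) (kd n) DY)
    by (now rewrite (cf_per_k _ _ _ _ H), (per_comb_N _ _ _ _ H a b : Y 1 = Y 0)).
  rewrite (wint_ext w _ (fun t => (-1) * (X t * (k 0%nat t * k n t))))
    by (intros; ring).
  rewrite wint_scal by (trivial; cont). ring. }
assert (Er : rho ^ 2 <= rho * (4 * d +
   (2 * A * (A + 1) ^ n + (INR p + 4)) * (eta * M))).
(* In [X^2 + Y^2], one factor [X] is replaced by Q = P + k v and one factor [Y] by v_s. [R0]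
   collects the errors and the term with P; what remains integrates to twice [s * I]. *)
{ set (R0 := fun t => X t * (X t - Q t) + Y t * (Y t - s * k (S n) t) + X t * P t).
  assert (E : rho ^ 2 = wint w (fun t => 1 * R0 t
     + 1 * (s * (X t * (k 0%nat t * k n t)) + s * (Y t * k (S n) t)))).
  { rewrite <- (wint_const w Wc W1 (rho ^ 2)). apply wint_ext; intros t.
    unfold rho; rewrite (rho_sqr a b), <- (comb_sqr _ _ _ _ H a b t).
    fold X Y; unfold R0; rewrite EQ; ring. }
  assert (CR : cont R0) by (unfold R0; cont).
  rewrite E, wint_lin, wint_lin, Bd by cont.
  set (I := wint w (fun t => X t * (k 0%nat t * k n t))) in *.
  assert (BR : Rabs (wint w R0) <= rho * (2 * d) + rho * (2 * d)
                                   + rho * ((INR p + 2) * (eta * M))).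
  { apply wint_abs_bound; trivial. intros t Ht; unfold R0.
    apply Rabs_plus_le; [apply Rabs_plus_le|]; apply Rabs_mult_le; trivial;
      try now apply BP.
    - rewrite Rabs_minus_sym; now apply B.
    - rewrite Rabs_minus_sym; now apply B. }
  assert (BI : Rabs (s * I) <= (A * (A + 1) ^ n + 1) * (eta * M * rho))
    by (rewrite Rabs_mult, As, Rmult_1_l; exact Bk).
  apply Rabs_le_between in BI; apply Rabs_le_between in BR.
  lra. }
(* Division by [rho]; when [rho = 0] the right-hand side is nonnegative anyway. *)
assert (Hr2 : rho <= 4 * d + (2 * A * (A + 1) ^ n + (INR p + 4)) * (eta * M)).
{ destruct Hr as [Hr|Hr].
  - apply (Rmult_le_reg_l rho); trivial. lra.
  - rewrite <- Hr. pose proof (pos_INR p).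
    pose proof (pow_le (A + 1) n ltac:(lra)).
    assert (0 <= eta * M) by now apply Rmult_le_pos.
    assert (0 <= A * (A + 1) ^ n) by now apply Rmult_le_pos.
    nra. }
(* Uses [kap * k n = s * (Q - P) - dev 0 * k n], valid because [s * s = 1], with Q within [2 * d] of
   [X] and [|X| <= rho]. *)
assert (F : Rabs (kap * k n t0) <= rho + 2 * d + (INR p + 2) * (eta * M) + eta * M).
{ replace (kap * k n t0) with (s * (X t0 + (Q t0 - X t0) + - P t0)
      + - (dev 0 t0 * k n t0)).
  - apply Rabs_plus_le.
    + rewrite Rabs_mult, As, Rmult_1_l.
      apply Rabs_plus_le; [apply Rabs_plus_le; trivial; now apply B|].
      rewrite Rabs_Ropp; now apply BP.
    + rewrite Rabs_Ropp; apply Rabs_mult_le; [|now apply HM].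
      eapply Rle_trans; [now apply abs_dev_le_norm1|trivial].
  - rewrite EQ; simpl dev.
    assert (s * s = 1) by (unfold s; rewrite <- Rpow_mult_distr;
      replace (-1 * -1) with 1 by ring; apply pow1).
    transitivity ((s * s) * (k 0%nat t0 * k n t0) - (k 0%nat t0 - kap) * k n t0);
      [ring|rewrite H0; ring]. }
rewrite Rabs_mult, HM0 in F; fold A in F.
unfold small_const. fold n. rewrite S_INR.
assert (0 <= eta * M) by now apply Rmult_le_pos.
lra.
Qed.

End Estimates.

(** * The gap inequality for curves of length one *)

Lemma small_const_pos A m : 0 <= A -> 0 < small_const A m.
Proof.
intros HA; unfold small_const. pose proof (pos_INR m).
pose proof (pow_le (A + 1) (2 * m) ltac:(lra)).
assert (0 <= A * (A + 1) ^ (2 * m)) by now apply Rmult_le_pos.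
lra.
Qed.

(** One summand for each regime of the proof below: 144 for small [k_m], the other for large
    [k_m]. *)
Definition gap_const (A : R) (m : nat) : R :=
  144 / A ^ 2 + 16 * small_const A m ^ 2 / A ^ 2.

(** The dichotomy is whether the L1 norm [eta] of [k_m] is small enough for the quadratic term of
    [sup_bound] to be absorbed. *)
Lemma unit_length_gap w T1 T2 k m :
  closed_frame w T1 T2 k -> (1 <= m)%nat -> wint w (k 0%nat) <> 0 ->
  wint w (fun t => k m t ^ 2)
    <= gap_const (Rabs (wint w (k 0%nat))) m * wint w (fun t => gradient k m t ^ 2).
Proof.
intros H Hm Hk.
pose proof (cf_cont _ _ _ _ H) as Wc; pose proof (cf_pos _ _ _ _ H) as Wp.
pose proof (cf_length _ _ _ _ H) as W1.
pose proof (cont_k _ _ _ _ H) as Ck.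
pose proof (cont_gradient _ _ _ _ H m) as CK.
set (A := Rabs (wint w (k 0%nat))).
assert (HA : 0 < A) by now apply Rabs_pos_lt.
pose proof (small_const_pos A m (Rlt_le _ _ HA)) as HC.
set (C := small_const A m) in *.
assert (CS := wint_cauchy_schwarz w Wc Wp W1 _ CK).
assert (CS2 := wint_cauchy_schwarz w Wc Wp W1 _ (Ck m)).
assert (EN := energy_le_gradient _ _ _ _ H m Hm).
set (e := wint w (fun t => k m t ^ 2)) in *.
set (d := wint w (fun t => Rabs (gradient k m t))) in *.
assert (SB := fun M t0 => sup_bound _ _ _ _ H m M t0 Hm); simpl in SB.
set (eta := wint w (fun t => Rabs (k m t))) in *.
assert (He : 0 <= e) by exact (wint_sqr_nonneg w Wc Wp W1 _ (Ck m)).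
assert (Hd : 0 <= d) by exact (wint_abs_nonneg w Wc Wp W1 _ CK).
assert (Heta : 0 <= eta) by exact (wint_abs_nonneg w Wc Wp W1 _ (Ck m)).
assert (HA2 : 0 < A ^ 2) by now apply pow_lt.
assert (HC2 : 0 < C ^ 2) by now apply pow_lt.
assert (G : e <= gap_const A m * d ^ 2).
{ unfold gap_const; fold C.
  assert (EG : A ^ 2 * ((144 / A ^ 2 + 16 * C ^ 2 / A ^ 2) * d ^ 2)
    = 144 * d ^ 2 + 16 * (C ^ 2 * d ^ 2)) by (field; lra).
  destruct (Rle_dec (2 * C * eta) A) as [Hs|Hl].
  - destruct (continuity_ab_maj (fun t => Rabs (k (2 * m)%nat t)) 0 1) as (t0 & Hmax & Ht0);
      [lra| |].
    { intros t _. apply continuity_pt_filterlim.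
      exact (cont_abs _ (Ck (2 * m)%nat) t). }
    set (M := Rabs (k (2 * m)%nat t0)) in *.
    assert (B := SB M t0 Hmax Ht0 eq_refl).
    change (A * M <= 6 * d + C * (eta * M)) in B.
    assert (HM : 0 <= M) by apply Rabs_pos.
    (* Here [C * eta <= A / 2], so half of [A * M] absorbs the quadratic term. *)
    assert (B2 : A * M <= 12 * d) by nra.
    assert (B3 : e <= M ^ 2).
    { unfold e; apply wint_le_bound; trivial; [cont|]. intros t Ht.
      rewrite <- pow2_abs. apply pow_incr; split; [apply Rabs_pos|].
      destruct m as [|p]; [lia|].
      apply (dev_le_sup _ _ _ _ H (2 * S p) M ltac:(lia) Hmax (S p)); [lia|trivial]. }
    assert (B4 : A ^ 2 * e <= 144 * d ^ 2).
    { assert ((A * M) ^ 2 <= (12 * d) ^ 2) by (apply pow_incr; split; [nra|trivial]).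
      nra. }
    apply (Rmult_le_reg_l (A ^ 2)); trivial.
    rewrite EG.
    assert (0 <= C ^ 2 * d ^ 2) by (apply Rmult_le_pos; [lra|apply pow2_ge_0]).
    lra.
  (* Now [eta^2 <= e] bounds [e] below by [A^2 / (4 C^2)]. The linear estimate [e <= 2 * d] becomes
     quadratic: [A^2 e <= 4 C^2 e^2 <= 16 C^2 d^2]. *)
  - apply Rnot_le_lt in Hl.
    assert (B : A ^ 2 <= 4 * C ^ 2 * e).
    { assert (A ^ 2 <= (2 * C * eta) ^ 2) by (apply pow_incr; lra). nra. }
    assert (B1 : e ^ 2 <= 4 * d ^ 2) by nra.
    apply (Rmult_le_reg_l (A ^ 2)); trivial.
    rewrite EG.
    assert (A ^ 2 * e <= 4 * C ^ 2 * e ^ 2) by nra.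
    assert (C ^ 2 * e ^ 2 <= C ^ 2 * (4 * d ^ 2)) by nra.
    pose proof (pow2_ge_0 d). lra. }
eapply Rle_trans; [exact G|]. apply Rmult_le_compat_l; trivial.
unfold gap_const; fold C.
assert (0 <= 144 / A ^ 2) by (apply Rdiv_le_0_compat; lra).
assert (0 <= 16 * C ^ 2 / A ^ 2) by (apply Rdiv_le_0_compat; lra).
lra.
Qed.

(** * Closed immersed curves *)

Lemma smooth_cont f : smooth f -> cont f.
Proof.
intros S t; apply (ex_derive_continuous (V := R_NormedModule)).
now apply smooth_ex_derive.
Qed.

Lemma fold_right_Rplus_app l x : fold_right Rplus 0 (l ++ x :: nil) = fold_right Rplus 0 l + x.
Proof. induction l as [|y l IH]; simpl; [ring|rewrite IH; ring]. Qed.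

Lemma Qsum_fold k m n t :
  Qsum k m n t = - / 2 * k m t ^ 2 + fold_right Rplus 0
    (map (fun r => (-1) ^ (r + 1) * k (m - r)%nat t * k (m + r)%nat t) (seq 1 n)).
Proof.
induction n as [|n IH]; [simpl; ring|].
rewrite seq_S, map_app; cbn [map].
rewrite fold_right_Rplus_app, <- Rplus_assoc, <- IH.
replace (1 + n)%nat with (S n) by lia.
cbn [Qsum]; rewrite pow_add; simpl; ring.
Qed.

(** Homogeneity: in each product the orders add up to [2 * m], and each of the two factors carries
    one more power of [L]. *)
Lemma Qsum_scale k L m n t : (n <= m)%nat ->
  Qsum (fun j t => L ^ S j * k j t) m n t = L ^ (2 * m + 2) * Qsum k m n t.
Proof.
induction n as [|n IH]; intros Hn; cbn [Qsum].
- replace (2 * m + 2)%nat with (S m + S m)%nat by lia. rewrite pow_add; ring.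
- rewrite IH by lia.
  replace (2 * m + 2)%nat with (S (m - S n) + S (m + S n))%nat by lia.
  rewrite pow_add; ring.
Qed.

Section Curve.

Context (cx cy : R -> R) (Hc : closed_immersed_curve cx cy).

Let Sx : smooth cx := proj1 Hc.
Let Sy : smooth cy := proj1 (proj2 Hc).
Let Hpos : forall t, 0 < Derive cx t ^ 2 + Derive cy t ^ 2 :=
  proj2 (proj2 (proj2 Hc)).

Lemma periodic_x : periodic cx.
Proof. intros t; apply Hc. Qed.

Lemma periodic_y : periodic cy.
Proof. intros t; apply Hc. Qed.

Lemma speed_pos t : 0 < speed cx cy t.
Proof. apply sqrt_lt_R0, Hpos. Qed.

Lemma speed_neq t : speed cx cy t <> 0.
Proof. apply Rgt_not_eq, speed_pos. Qed.

Lemma speed_sqr t : speed cx cy t ^ 2 = Derive cx t ^ 2 + Derive cy t ^ 2.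
Proof. apply pow2_sqrt, Rlt_le, Hpos. Qed.

Lemma smooth_speed : smooth (speed cx cy).
Proof.
apply (smooth_sqrt (fun t => Derive cx t ^ 2 + Derive cy t ^ 2)); [apply Hpos|].
apply (smooth_plus (fun t => Derive cx t ^ 2) (fun t => Derive cy t ^ 2));
  apply smooth_pow; now apply smooth_Derive.
Qed.

Lemma periodic_speed : periodic (speed cx cy).
Proof.
intros t; unfold speed.
rewrite (periodic_Derive cx Sx periodic_x t), (periodic_Derive cy Sy periodic_y t).
reflexivity.
Qed.

Lemma smooth_curvature : smooth (curvature cx cy).
Proof.
assert (S1 := smooth_Derive _ Sx). assert (S2 := smooth_Derive _ Sy).
assert (S3 := smooth_Derive _ S1). assert (S4 := smooth_Derive _ S2).
replace (curvature cx cy) with (fun t =>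
  (Derive cx t * Derive (Derive cy) t + (-1) * (Derive cy t * Derive (Derive cx) t))
  * / (speed cx cy t ^ 3)).
2:{ apply functional_extensionality; intros t.
    unfold curvature, Rdiv. change (Derive_n cx 2) with (Derive (Derive cx)).
    change (Derive_n cy 2) with (Derive (Derive cy)). ring. }
apply smooth_mult.
- apply smooth_plus; [now apply smooth_mult|].
  apply smooth_mult; [apply smooth_const|now apply smooth_mult].
- apply smooth_inv; [intros t; apply pow_nonzero, speed_neq|].
  apply smooth_pow, smooth_speed.
Qed.

Lemma periodic_curvature : periodic (curvature cx cy).
Proof.
assert (S1 := smooth_Derive _ Sx). assert (S2 := smooth_Derive _ Sy).
assert (P1 := periodic_Derive _ Sx periodic_x). assert (P2 := periodic_Derive _ Sy periodic_y).
intros t; unfold curvature. rewrite periodic_speed, P1, P2.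
change (Derive_n cx 2) with (Derive (Derive cx)).
change (Derive_n cy 2) with (Derive (Derive cy)).
now rewrite (periodic_Derive _ S1 P1), (periodic_Derive _ S2 P2).
Qed.

Lemma smooth_periodic_k_s j : smooth (k_s cx cy j) /\ periodic (k_s cx cy j).
Proof.
induction j as [|j [IS IP]]; [split; [apply smooth_curvature|apply periodic_curvature]|].
split.
- apply (smooth_mult (Derive (k_s cx cy j)) (fun t => / speed cx cy t)).
  + now apply smooth_Derive.
  + apply smooth_inv; [apply speed_neq|apply smooth_speed].
- intros t; change (Derive (k_s cx cy j) (t + 1) / speed cx cy (t + 1)
    = Derive (k_s cx cy j) t / speed cx cy t).
  now rewrite (periodic_Derive _ IS IP), periodic_speed.
Qed.

Lemma periodic_01 f : periodic f -> f 1 = f 0.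
Proof. intros P; rewrite <- (P 0); f_equal; ring. Qed.

Lemma speed_derive t : is_derive (speed cx cy) t
  ((Derive cx t * Derive_n cx 2 t + Derive cy t * Derive_n cy 2 t) / speed cx cy t).
Proof.
assert (D1 := smooth_ex_derive _ t (smooth_Derive _ Sx)).
assert (D2 := smooth_ex_derive _ t (smooth_Derive _ Sy)).
pose proof (speed_neq t) as N; unfold speed in *.
auto_derive; [repeat split; trivial; apply Hpos|].
change (Derive_n cx 2 t) with (Derive (fun x => Derive cx x) t).
change (Derive_n cy 2 t) with (Derive (fun x => Derive cy x) t).
simpl in N |- *. field. exact N.
Qed.

(** With the next lemma, the Frenet equation T_s = k N in the parameter t: multiplied by the speed,
    the components of N become [- Derive cy] and [Derive cx]. *)
Lemma tangent_x_derive t :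
  is_derive (fun t => Derive cx t / speed cx cy t) t (- (curvature cx cy t * Derive cy t)).
Proof.
assert (D1 := Derive_correct _ t (smooth_ex_derive _ t (smooth_Derive _ Sx))).
assert (D := is_derive_div _ _ _ _ _ D1 (speed_derive t) (speed_neq t)).
replace (- (curvature cx cy t * Derive cy t)) with
  ((Derive (Derive cx) t * speed cx cy t
    - Derive cx t * ((Derive cx t * Derive_n cx 2 t + Derive cy t * Derive_n cy 2 t)
                      / speed cx cy t)) / speed cx cy t ^ 2); [exact D|].
unfold curvature. change (Derive (Derive cx) t) with (Derive_n cx 2 t).
pose proof (speed_neq t) as N.
(* Brings out the square of the speed, which [speed_sqr] turns into a polynomial in the first
   derivatives. *)
transitivity ((Derive_n cx 2 t * speed cx cy t ^ 2
    - (Derive cx t * Derive_n cx 2 t + Derive cy t * Derive_n cy 2 t) * Derive cx t)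
    / speed cx cy t ^ 3); [field; exact N|].
rewrite speed_sqr. field; exact N.
Qed.

Lemma tangent_y_derive t :
  is_derive (fun t => Derive cy t / speed cx cy t) t (curvature cx cy t * Derive cx t).
Proof.
assert (D1 := Derive_correct _ t (smooth_ex_derive _ t (smooth_Derive _ Sy))).
assert (D := is_derive_div _ _ _ _ _ D1 (speed_derive t) (speed_neq t)).
replace (curvature cx cy t * Derive cx t) with
  ((Derive (Derive cy) t * speed cx cy t
    - Derive cy t * ((Derive cx t * Derive_n cx 2 t + Derive cy t * Derive_n cy 2 t)
                      / speed cx cy t)) / speed cx cy t ^ 2); [exact D|].
unfold curvature. change (Derive (Derive cy) t) with (Derive_n cy 2 t).
pose proof (speed_neq t) as N.
transitivity ((Derive_n cy 2 t * speed cx cy t ^ 2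
    - (Derive cx t * Derive_n cx 2 t + Derive cy t * Derive_n cy 2 t) * Derive cy t)
    / speed cx cy t ^ 3); [field; exact N|].
rewrite speed_sqr. field; exact N.
Qed.



Lemma cont_speed : cont (speed cx cy).
Proof. apply smooth_cont, smooth_speed. Qed.

Lemma curve_int_derive f : smooth f -> periodic f ->
  cont (fun t => Derive f t / speed cx cy t) ->
  curve_int cx cy (fun t => Derive f t / speed cx cy t) = 0.
Proof.
intros S P C.
change (wint (speed cx cy) (fun t => Derive f t / speed cx cy t) = 0).
rewrite (wint_ds _ f); trivial.
- rewrite (periodic_01 _ P); ring.
- apply cont_speed.
- intros t. replace (_ * _) with (Derive f t) by (field; apply speed_neq).
  now apply Derive_correct, smooth_ex_derive.
Qed.

(** * Dilation to length one *)

Let L := length cx cy.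

Lemma length_pos : 0 < L.
Proof.
apply RInt_gt_0; [lra| |].
- intros t _; rewrite Rmult_1_l; apply speed_pos.
- intros t _. pose proof cont_speed. revert t; change (cont (fun t => 1 * speed cx cy t)). cont.
Qed.

(** The speed after dilation by the factor 1/L. The unit tangent is unchanged, and [unit_k] below
    gives the derivatives of the dilated curvature. *)
Definition unit_speed (t : R) : R := speed cx cy t / L.

Lemma wint_unit_speed f : cont f -> wint unit_speed f = curve_int cx cy f / L.
Proof.
intros F; pose proof length_pos.
transitivity (wint (speed cx cy) (fun t => / L * f t)).
- apply wint_ext_weight; intros t; unfold unit_speed, Rdiv; ring.
- rewrite wint_scal; trivial; [|apply cont_speed].
  unfold wint, curve_int; field; lra.
Qed.

Definition unit_k (j : nat) (t : R) : R := L ^ S j * k_s cx cy j t.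

Lemma unit_closed_frame :
  closed_frame unit_speed
    (fun t => Derive cx t / speed cx cy t) (fun t => Derive cy t / speed cx cy t) unit_k.
Proof.
pose proof length_pos as HL. pose proof speed_neq as N.
assert (S1 := smooth_Derive _ Sx). assert (S2 := smooth_Derive _ Sy).
assert (P1 := periodic_Derive _ Sx periodic_x). assert (P2 := periodic_Derive _ Sy periodic_y).
assert (CT1 : cont (fun t => Derive cx t / speed cx cy t)).
{ intros t; apply (ex_derive_continuous (V := R_NormedModule)); eexists; apply tangent_x_derive. }
assert (CT2 : cont (fun t => Derive cy t / speed cx cy t)).
{ intros t; apply (ex_derive_continuous (V := R_NormedModule)); eexists; apply tangent_y_derive. }
split.
- pose proof cont_speed; unfold unit_speed, Rdiv; cont.
- intros t; apply Rdiv_lt_0_compat; [apply speed_pos|trivial].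
- rewrite wint_unit_speed by cont. unfold L, length; field. unfold L, length in HL; lra.
- intros t. replace (_ * unit_speed t) with (- (curvature cx cy t * Derive cy t));
    [apply tangent_x_derive|].
  unfold unit_k, unit_speed; simpl; field; split; [lra|apply N].
- intros t. replace (_ * unit_speed t) with (curvature cx cy t * Derive cx t);
    [apply tangent_y_derive|].
  unfold unit_k, unit_speed; simpl; field; split; [lra|apply N].
- intros t. unfold Rdiv; rewrite !Rpow_mult_distr, <- Rmult_plus_distr_r, <- speed_sqr.
  field; apply N.
- intros j t. destruct (smooth_periodic_k_s j) as [Sk _].
  replace (_ * unit_speed t) with (L ^ S j * Derive (k_s cx cy j) t).
  + apply is_derive_scal, Derive_correct; now apply smooth_ex_derive.
  + unfold unit_k, unit_speed. change (k_s cx cy (S j) t)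
      with (Derive (k_s cx cy j) t / speed cx cy t).
    simpl; field; split; [lra|apply N].
- now rewrite (periodic_01 _ P1), (periodic_01 _ periodic_speed).
- now rewrite (periodic_01 _ P2), (periodic_01 _ periodic_speed).
- intros j; unfold unit_k; now rewrite (periodic_01 _ (proj2 (smooth_periodic_k_s j))).
- rewrite wint_unit_speed by trivial. rewrite curve_int_derive;
    [unfold Rdiv; ring|exact Sx|apply periodic_x|trivial].
- rewrite wint_unit_speed by trivial. rewrite curve_int_derive;
    [unfold Rdiv; ring|exact Sy|apply periodic_y|trivial].
Qed.

(** K_m is homogeneous: [L ^ (2 * m + 3)] comes from [k_{s^{2m+2}}], and equally from one factor [k]
    times the weight [2 * m + 2] of Q. *)
Lemma gradient_unit_k m t : gradient unit_k m t = L ^ (2 * m + 3) * Kop m cx cy t.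
Proof.
unfold gradient, unit_k at 1 2, Kop.
assert (E := Qsum_scale (k_s cx cy) L m m t (le_n m)); fold unit_k in E; rewrite E.
rewrite Qsum_fold.
change (k_s cx cy 0 t) with (curvature cx cy t).
replace (2 * m + 3)%nat with (S (2 * m + 2)) by lia.
rewrite <- !(tech_pow_Rmult L), pow_O. ring.
Qed.

End Curve.

(** * The inequality for curves of arbitrary length *)

Theorem theorem1p2 (m : nat) (w : Z) :
  (1 <= m)%nat -> w <> 0%Z ->
  exists C : R, 0 < C /\
    forall cx cy : R -> R,
      closed_immersed_curve cx cy ->
      turning_number cx cy = IZR w ->
      curve_int cx cy (fun t => Kop m cx cy t ^ 2)
        >= C * / (length cx cy ^ (2 * m + 4)) * energy m cx cy.
Proof.
intros Hm Hw.
pose proof PI_RGT_0 as HPI.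
set (A := Rabs (2 * PI * IZR w)).
assert (HA : 0 < A).
{ apply Rabs_pos_lt. apply Rmult_integral_contrapositive; split; [lra|].
  now apply not_0_IZR. }
assert (HG : 0 < gap_const A m).
{ unfold gap_const. assert (0 < A ^ 2) by now apply pow_lt.
  assert (0 < small_const A m ^ 2) by (apply pow_lt, small_const_pos; lra).
  apply Rplus_lt_0_compat; apply Rdiv_lt_0_compat; lra. }
(* The 2 compensates the factor 1/2 in E_m. [A] is the absolute value of the mean curvature at unit
   length, so the constant depends only on [m] and [w]. *)
exists (2 / gap_const A m); split; [apply Rdiv_lt_0_compat; lra|].
intros cx cy Hc Ht.
pose proof (length_pos cx cy Hc) as HL.
pose proof (unit_closed_frame cx cy Hc) as F.
assert (CK : cont (Kop m cx cy)).
{ pose proof (cont_gradient _ _ _ _ F m) as CG.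
  replace (Kop m cx cy) with (fun t => / length cx cy ^ (2 * m + 3)
                                       * gradient (unit_k cx cy) m t); [cont|].
  apply functional_extensionality; intros t.
  rewrite gradient_unit_k; field; apply pow_nonzero; lra. }
assert (Ck : forall j, cont (k_s cx cy j))
  by (intros j; apply smooth_cont, smooth_periodic_k_s, Hc).
set (L := length cx cy) in *.
set (E := curve_int cx cy (fun t => k_s cx cy m t ^ 2)).
set (D := curve_int cx cy (fun t => Kop m cx cy t ^ 2)).
(* Total curvature is invariant under dilation, so the turning number fixes the mean [kap]. *)
assert (E0 : wint (unit_speed cx cy) (unit_k cx cy 0) = 2 * PI * IZR w).
{ rewrite wint_unit_speed by (trivial; unfold unit_k; cont).
  unfold turning_number in Ht. rewrite <- Ht.
  change (curve_int cx cy (unit_k cx cy 0))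
    with (wint (speed cx cy) (fun t => L ^ 1 * k_s cx cy 0 t)).
  rewrite wint_scal by (trivial; now apply cont_speed).
  change (wint (speed cx cy) (k_s cx cy 0)) with (curve_int cx cy (curvature cx cy)).
  fold L; field; split; lra. }
assert (E1 : wint (unit_speed cx cy) (fun t => unit_k cx cy m t ^ 2) = L ^ (2 * m + 1) * E).
{ rewrite wint_unit_speed by (trivial; unfold unit_k; cont).
  transitivity (wint (speed cx cy) (fun t => L ^ (2 * m + 2) * k_s cx cy m t ^ 2) / L).
  - unfold Rdiv; f_equal; apply (wint_ext (speed cx cy)); intros t. unfold unit_k; fold L.
    replace (2 * m + 2)%nat with (S m + S m)%nat by lia. rewrite pow_add; ring.
  - rewrite wint_scal by (cont; now apply cont_speed).
    replace (2 * m + 2)%nat with (S (2 * m + 1)) by lia.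
    change (wint (speed cx cy) (fun t => k_s cx cy m t ^ 2)) with E.
    rewrite <- tech_pow_Rmult; field; lra. }
(* The exponent is [2 * (2 * m + 3) - 1], the minus one coming from ds; it is split so that the
   factor [L ^ (2 * m + 1)] of [E1] cancels. *)
assert (E2 : wint (unit_speed cx cy) (fun t => gradient (unit_k cx cy) m t ^ 2)
             = L ^ (2 * m + 1) * (L ^ (2 * m + 4) * D)).
{ pose proof (cont_gradient _ _ _ _ F m).
  rewrite wint_unit_speed by (trivial; cont).
  transitivity (wint (speed cx cy) (fun t => L ^ (S (2 * m + 1 + (2 * m + 4))) * Kop m cx cy t ^ 2) / L).
  - unfold Rdiv; f_equal; apply (wint_ext (speed cx cy)); intros t. rewrite gradient_unit_k; fold L.
    replace (S (2 * m + 1 + (2 * m + 4))) with ((2 * m + 3) + (2 * m + 3))%nat by lia.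
    rewrite (pow_add L (2 * m + 3)); ring.
  - rewrite wint_scal by (cont; now apply cont_speed).
    change (wint (speed cx cy) (fun t => Kop m cx cy t ^ 2)) with D.
    rewrite <- tech_pow_Rmult, (pow_add L (2 * m + 1)); field; lra. }
assert (G := unit_length_gap _ _ _ _ m F Hm).
rewrite E0, E1, E2 in G.
specialize (G ltac:(intros Z; unfold A in HA; rewrite Z, Rabs_R0 in HA; lra)).
fold A in G.
set (g := gap_const A m) in *.
assert (HL1 : 0 < L ^ (2 * m + 1)) by now apply pow_lt.
assert (HL4 : 0 < L ^ (2 * m + 4)) by now apply pow_lt.
assert (G2 : E <= g * (L ^ (2 * m + 4) * D)).
{ apply (Rmult_le_reg_l (L ^ (2 * m + 1))); trivial. lra. }
change (energy m cx cy) with (/ 2 * E).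
apply Rle_ge, (Rmult_le_reg_l (g * L ^ (2 * m + 4))); [now apply Rmult_lt_0_compat|].
replace (_ * (2 / g * _ * _)) with E by (field; lra).
lra.
Qed.
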